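(* Let $k\geq 2$ be an integer and let $M\in\mathbb{C}[x_0,\ldots,x_n]$ be a monomial of degree $kd$. Then $\#_k(M)\leq 2^{k-1}$. Moreover, $\#_k(M)=2$ if and only if $k=2$ and $M$ is not a square.
   Context: Let $S=\bigoplus_{i\in\mathbb{N}}S_i=\mathbb{C}[x_0,\ldots,x_n]$ with the standard grading; a form of degree $d$ is an element of $S_d$ (forms of degree $0$ are constants). A monomial is a product $x_0^{a_0}\cdots x_n^{a_n}$ with non-negative integer exponents. For an integer $k\geq 2$ and a form $F\in S_{kd}$, the $k^{th}$-Waring rank ($k^{th}$-rank) of $F$ is $\#_k(F):=\min\{s \mid F=g_1^k+\cdots+g_s^k \text{ for some forms } g_1,\ldots,g_s\in S_d\}$. *)

(* Defs.v *)
From HB Require Import structures.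
From mathcomp Require Import all_boot all_order all_algebra.
From mathcomp Require Import reals.
From mathcomp Require Import complex.
From mathcomp Require Import mpoly.

Set Implicit Arguments.
Unset Strict Implicit.
Unset Printing Implicit Defensive.

Import GRing.Theory.
Local Open Scope ring_scope.

(* [F = g_1^k + ... + g_s^k] with every [g_i] in [S_d]; as [S_d] is a vector
   space, the zero polynomial is allowed among the [g_i]. *)
Definition sum_of_kth_powers (K : comNzRingType) (m k d : nat)
    (F : {mpoly K[m]}) (s : nat) : Prop :=
  exists g : 'I_s -> {mpoly K[m]},
    (forall i, g i \is d.-homog) /\ F = \sum_(i < s) g i ^+ k.

(* The rank of [F], as a minimum, is given by its graph: there is at most one
   such [s], and there is none when [F] is not a sum of k-th powers. *)
Definition is_kth_rank (K : comNzRingType) (m k d : nat)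
    (F : {mpoly K[m]}) (s : nat) : Prop :=
  sum_of_kth_powers k d F s /\
  forall t : nat, sum_of_kth_powers k d F t -> (s <= t)%N.

Definition is_square (K : comNzRingType) (m : nat) (F : {mpoly K[m]}) : Prop :=
  exists N : {mpoly K[m]}, F = N ^+ 2.

(* Main.v *)
Require Import Defs.
From HB Require Import structures.
From mathcomp Require Import all_boot all_order all_algebra.
From mathcomp Require Import separable cyclotomic ring.
From mathcomp Require Import boolp.
From mathcomp Require Import reals.
From mathcomp Require Import complex.
From mathcomp Require Import mpoly.

Set Implicit Arguments.
Unset Strict Implicit.
Unset Printing Implicit Defensive.

Import Order.TTheory GRing.Theory Num.Theory.
Local Open Scope ring_scope.

(** Upper bound.  A monomial of degree [k * d] is a product of [k] monomials
    [x, y_1, ..., y_(k-1)] of degree [d].  Taking the central difference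
    [h(z + y) - h(z - y)] of [z ^+ k] successively in the [k - 1] directions
    [y_j] and evaluating at [x] yields a nonzero integer multiple of
    [x * y_1 * ... * y_(k-1)] ([central_diff_powS]); on the other hand it is by
    construction a signed sum of [2 ^ k.-1] [k]-th powers of forms of degree
    [d], and over an algebraically closed field every scalar is a [k]-th power
    and can be absorbed into the forms ([prod_sum_of_kth_powers]).

    Rank two.  If [k >= 3] and a monomial equals [f ^+ k + g ^+ k], then, after
    multiplying [g] by a [k]-th root of [-1], it equals [f ^+ k - g ^+ k] and
    is divisible by [f - z *: g] for every [k]-th root of unity [z].  Divisors
    of a monomial are monomials up to a scalar ([mpolyX_divisor]).  Three such
    divisors lie in the plane spanned by [f] and [g], hence satisfy a linear
    relation, and its coefficients are nonzero because the roots of unity are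
    distinct: so they all are multiples of one monomial, hence so are [f] and
    [g], and the given monomial is itself a [k]-th power
    ([mpolyX_sum_two_powers]).  Its rank is then at most one.  For [k = 2] the
    upper bound is two, and rank one means being a square; a monomial that is
    a square is the square of a form of the right degree, namely of a monomial
    ([kth_power_monomial]). *)

(** * Central differences of powers *)

Fixpoint central_diff (A : comNzRingType) (s : seq A) (h : A -> A) : A -> A :=
  if s is y :: s' then central_diff s' (fun z => h (z + y) - h (z - y)) else h.

Lemma eq_central_diff (A : comNzRingType) (s : seq A) (h1 h2 : A -> A) :
  h1 =1 h2 -> central_diff s h1 =1 central_diff s h2.
Proof.
elim: s h1 h2 => [//|y s IHs] h1 h2 eq_h x /=.
by apply: IHs => z; rewrite !eq_h.
Qed.

Lemma central_diff_sum (A : comNzRingType) (s : seq A) m (c : 'I_m -> A)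
    (h : 'I_m -> A -> A) x :
  central_diff s (fun z => \sum_(i < m) c i * h i z) x =
  \sum_(i < m) c i * central_diff s (h i) x.
Proof.
elim: s h => [//|y s IHs] h /=.
rewrite -IHs; apply: eq_central_diff => z.
by rewrite -sumrB; apply: eq_bigr => i _; rewrite mulrBr.
Qed.

(** The binomial expansion of [(z + y) ^+ n - (z - y) ^+ n], in which the terms
    of even index [i] vanish: one difference lowers the exponent by an odd
    number. *)
Lemma central_diff_pow_cons (A : comNzRingType) (y : A) s n x :
  central_diff (y :: s) (fun z => z ^+ n) x =
  \sum_(i < n.+1) (1 - (-1) ^+ i) * y ^+ i *+ 'C(n, i)
                  * central_diff s (fun z => z ^+ (n - i)) x.
Proof.
rewrite -central_diff_sum /=; apply: eq_central_diff => z.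
rewrite !exprDn -sumrB; apply: eq_bigr => i _.
rewrite (exprNn y) -mulrnBl mulrnAl; congr (_ *+ _); ring.
Qed.

Lemma central_diff_pow_lt (A : comNzRingType) (s : seq A) n x :
  (n < size s)%N -> central_diff s (fun z => z ^+ n) x = 0.
Proof.
elim: s n => [//|y s IHs] n; rewrite ltnS => le_ns.
rewrite central_diff_pow_cons big_ord_recl expr0 subrr.
rewrite !mul0r mul0rn mul0r add0r.
apply: big1 => i _; rewrite IHs ?mulr0 //.
apply: leq_trans le_ns.
by rewrite /= /bump ltn_subrL (leq_ltn_trans _ (ltn_ord i)).
Qed.

(** [size s] differences of a power of exponent [(size s).+1] leave a polynomial
    of degree one in [x].  It has no constant term, since each difference
    changes the parity of the exponent. *)
Lemma central_diff_powS (A : comNzRingType) (s : seq A) x :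
  central_diff s (fun z => z ^+ (size s).+1) x =
  (2 ^ size s * (size s).+1`!)%:R * (x * \prod_(y <- s) y).
Proof.
elim: s => [|y s IHs]; first by rewrite big_nil /= expr1 mulr1 mul1r.
rewrite central_diff_pow_cons !big_ord_recl /=.
rewrite expr0 subrr !mul0r add0r.
rewrite /bump /= !addn0 add1n subn1 /= IHs.
(* Lowering the exponent by one leaves the induction hypothesis, by two a zero
   coefficient, and by three or more an exponent too small to survive. *)
rewrite !expr1 bin1 sqrrN expr1n subrr mul0r mul0rn mul0r add0r.
rewrite [X in _ + X = _]big1 ?addr0 => [|i _]; last first.
  rewrite central_diff_pow_lt ?mulr0 // !add1n !subSS.
  by rewrite ltn_subrL (leq_ltn_trans _ (ltn_ord i)).
rewrite big_cons expnS (factS (size s).+1) !natrM -mulr_natr; ring.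
Qed.

(** * Sums of [k]-th powers of forms *)

Section KthPowers.

Variables (C : numClosedFieldType) (m k d : nat).
Hypothesis k_gt0 : (0 < k)%N.
Implicit Types F G : {mpoly C[m]}.

Lemma sum_of_kth_powers1 F :
  sum_of_kth_powers k d F 1 <-> exists2 g, g \is d.-homog & F = g ^+ k.
Proof.
split=> [[g [hg ->]]|[g hg ->]]; first by exists (g ord0); rewrite ?big_ord1.
by exists (fun=> g); rewrite big_ord1.
Qed.

Lemma sum_of_kth_powersD F G s t :
  sum_of_kth_powers k d F s -> sum_of_kth_powers k d G t ->
  sum_of_kth_powers k d (F + G) (s + t).
Proof.
move=> [f [hf ->]] [g [hg ->]].
exists (fun i => match split i with inl j => f j | inr j => g j end); split.
  by move=> i; case: (split i).
rewrite big_split_ord /=; congr (_ + _); apply: eq_bigr => i _.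
  case: splitP => j /=; first by move/val_inj->.
  by move=> e; have := ltn_ord i; rewrite e ltnNge leq_addr.
case: splitP => j /=; last by move/addnI/val_inj->.
by move=> e; have := ltn_ord j; rewrite -e ltnNge leq_addr.
Qed.

Lemma sum_of_kth_powersZ c F s :
  sum_of_kth_powers k d F s -> sum_of_kth_powers k d (c *: F) s.
Proof.
move=> [f [hf ->]]; exists (fun i => k.-root c *: f i); split=> [i|].
  exact: dhomogZ.
by rewrite scaler_sumr; apply: eq_bigr => i _; rewrite exprZn rootCK.
Qed.

(** Each difference doubles the number of powers; the minus sign costs nothing
    since [-1] is itself a [k]-th power of a scalar. *)
Lemma central_diff_sum_of_kth_powers (s : seq {mpoly C[m]}) h N x :
    (forall z, z \is d.-homog -> sum_of_kth_powers k d (h z) N) ->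
    {in s, forall y, y \is d.-homog} -> x \is d.-homog ->
  sum_of_kth_powers k d (central_diff s h x) (2 ^ size s * N).
Proof.
elim: s h N => [|y s IHs] h N hh hs hx /=; first by rewrite mul1n; apply: hh.
have hy : y \is d.-homog by apply: hs; rewrite mem_head.
rewrite expnS mulnAC mulnC mul2n; apply: IHs => // [z hz|z zs].
  rewrite -addnn -scaleN1r; apply: sum_of_kth_powersD.
    by apply: hh; apply: rpredD.
  by apply: sum_of_kth_powersZ; apply: hh; apply: rpredB.
by apply: hs; rewrite inE zs orbT.
Qed.

Lemma prod_sum_of_kth_powers x (s : seq {mpoly C[m]}) :
    k = (size s).+1 -> x \is d.-homog -> {in s, forall y, y \is d.-homog} ->
  sum_of_kth_powers k d (x * \prod_(y <- s) y) (2 ^ k.-1).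
Proof.
move=> Dk hx hs; set c : C := (2 ^ size s * (size s).+1`!)%:R.
have c_neq0 : c != 0.
  by rewrite pnatr_eq0 muln_eq0 negb_or expn_eq0 -lt0n fact_gt0.
have -> : x * \prod_(y <- s) y = c^-1 *: central_diff s (fun z => z ^+ k) x.
  rewrite Dk central_diff_powS -[_%:R in RHS](@rmorph_nat _ _ (@mpolyC m C)).
  by rewrite mul_mpolyC scalerA mulVf // scale1r.
apply: sum_of_kth_powersZ.
rewrite Dk /= -[X in sum_of_kth_powers _ _ _ X]muln1 -Dk.
apply: central_diff_sum_of_kth_powers => // z hz.
by apply/sum_of_kth_powers1; exists z.
Qed.

End KthPowers.

(** * Splitting a monomial into factors of equal degree *)

Lemma mnm_split m (a : 'X_{1..m}) e :
  (e <= mdeg a)%N -> exists b c : 'X_{1..m}, a = (b + c)%MM /\ mdeg b = e.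
Proof.
elim: e => [_|e IHe lt_ea].
  by exists 0%MM, a; rewrite add0m mdeg0.
have [b [c [Da Db]]] := IHe (ltnW lt_ea).
have [i ci] : exists i, (0 < c i)%N.
  apply/existsP; apply: contraLR lt_ea => /existsPn c0.
  rewrite -leqNgt Da mdegD Db (_ : mdeg c = 0%N) ?addn0 //.
  by rewrite mdegE big1 // => i _; apply/eqP; rewrite -leqn0 leqNgt c0.
(* Move one variable from the remaining part [c] to [b]. *)
exists (b + U_(i))%MM, (c - U_(i))%MM; split; last first.
  by rewrite mdegD mdeg1 Db addn1.
apply/mnmP => j; rewrite Da !mnmDE mnmBE mnm1E -addnA; congr (_ + _)%N.
by case: eqP => [<-|_]; rewrite ?subn0 ?add0n // subnKC.
Qed.

Lemma mpolyX_factor (C : comNzRingType) m k d (a : 'X_{1..m}) :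
    mdeg a = (k * d)%N ->
  exists s : seq {mpoly C[m]},
    [/\ size s = k, {in s, forall y, y \is d.-homog}
      & 'X_[a] = \prod_(y <- s) y].
Proof.
elim: k a => [|k IHk] a Da.
  exists [::]; split=> //; rewrite big_nil.
  by move/eqP: Da; rewrite mdeg_eq0 => /eqP->; rewrite mpolyX0.
have [|b [c [Dbc Db]]] := @mnm_split _ a d; first by rewrite Da mulSn leq_addr.
have [|s [sz_s hs Ds]] := IHk c.
  by apply/(@addnI d); rewrite -mulSn -Da Dbc mdegD Db.
exists ('X_[b] :: s); split; first by rewrite /= sz_s.
  by move=> y /predU1P[->|/hs//]; rewrite dhomogX /= Db.
by rewrite big_cons -Ds Dbc mpolyXD.
Qed.

(** * Divisors of monomials *)

Section MonomialFactors.

Variables (C : idomainType) (m : nat).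
Implicit Types p q : {mpoly C[m]}.

(** The smallest monomial of a product arises in one way only, as for the
    leading one.  After splitting off the last term of [p], what remains times
    [q] only has monomials that are strictly larger. *)
Lemma mcoeffM_mlast p q :
  (p * q)@_(mlast p + mlast q) = p@_(mlast p) * q@_(mlast q).
Proof.
pose p' := p - p@_(mlast p) *: 'X_[mlast p].
have Dp : p = p@_(mlast p) *: 'X_[mlast p] + p' by rewrite addrC subrK.
rewrite [X in (X * q)@__]Dp mulrDl mcoeffD -scalerAl mcoeffZ ['X_[_] * _]mulrC.
rewrite mcoeffMX [X in _ + X](_ : _ = 0) ?addr0 //.
apply/eqP; apply: contraT => nz.
have /msuppM_le/allpairsP[[u v] /= [up' vq Duv]] :
  (mlast p + mlast q)%MM \in msupp (p' * q) by rewrite mcoeff_msupp.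
have lt_pu : (mlast p < u)%O.
  move: up'; rewrite mcoeff_msupp mcoeffB mcoeffZ mcoeffX.
  rewrite lt_neqAle.
  have [<-|ne_pu] := eqVneq (mlast p) u; first by rewrite mulr1 subrr eqxx.
  by rewrite mulr0 subr0 /= -mcoeff_msupp => /mlast_lemc.
have := ltmc_le_add lt_pu (mlast_lemc vq).
by rewrite -Duv ltxx.
Qed.

(** Both the leading and the last monomials of [p] and [q] multiply to the only
    monomial of [p * q].  As the last is at most the leading one in either
    factor, they coincide, so [p] has a single term. *)
Lemma mpolyX_divisor (a : 'X_{1..m}) p q :
  'X_[a] = p * q -> exists c b, p = c *: 'X_[b].
Proof.
move=> Dpq; have nz_pq : p * q != 0.
  by rewrite -Dpq -msupp_eq0 msuppX.
have [nz_p nz_q] : p != 0 /\ q != 0.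
  by apply/andP; rewrite -negb_or -mulf_eq0.
have Dlead : (mlead p + mlead q)%MM = a by rewrite -mleadM // -Dpq mleadXm.
have Dlast : (mlast p + mlast q)%MM = a.
  have : (p * q)@_(mlast p + mlast q) != 0.
    by rewrite mcoeffM_mlast mulf_neq0 // -mcoeff_msupp mlast_supp.
  by rewrite -Dpq mcoeffX; case: (a =P _) => [<-//|]; rewrite eqxx.
have le_p : (mlast p <= mlead p)%O by apply: mlast_lemc; apply: mlead_supp.
have le_q : (mlast q <= mlead q)%O by apply: mlast_lemc; apply: mlead_supp.
have eq_p : mlast p = mlead p.
  apply/eqP; apply: contraT => ne_p.
  have lt_p : (mlast p < mlead p)%O by rewrite lt_neqAle ne_p.
  by have := ltmc_le_add lt_p le_q; rewrite Dlead Dlast ltxx.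
exists p@_(mlead p), (mlead p); apply/mpolyP => u.
rewrite mcoeffZ mcoeffX; have [<-|ne_u] := eqVneq; first by rewrite mulr1.
rewrite mulr0; apply/eqP; apply: contraR ne_u; rewrite -mcoeff_msupp => up.
apply/eqP; apply: le_anti.
by rewrite -{1}eq_p mlast_lemc ?msupp_le_mlead.
Qed.

(** If [b1] and [b2] differed, then [c3 *: 'X_[b3]] would have to cancel the
    terms at both of them. *)
Lemma three_terms_proportional (b1 b2 b3 : 'X_{1..m}) (c1 c2 c3 : C) :
    c1 != 0 -> c2 != 0 ->
    c1 *: 'X_[b1] + c2 *: 'X_[b2] + c3 *: 'X_[b3] = 0 :> {mpoly C[m]} ->
  b1 = b2.
Proof.
move=> nz1 nz2 /mpolyP eq0; apply/eqP; apply: contraT => ne12.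
have := eq0 b1; have := eq0 b2.
rewrite !mcoeffD !mcoeffZ !mcoeffX !eqxx !mcoeff0 [b2 == b1]eq_sym (negPf ne12).
rewrite !mulr0 !mulr1 add0r addr0.
have [->|ne3] := eqVneq b3 b2; last first.
  by rewrite mulr0 addr0 => /eqP; rewrite (negPf nz2).
rewrite [b2 == b1]eq_sym (negPf ne12) mulr0 !addr0 => _ /eqP.
by rewrite (negPf nz1).
Qed.

End MonomialFactors.

(** * Monomials that are sums of two powers *)

Lemma three_unity_roots (C : numClosedFieldType) k :
    (3 <= k)%N ->
  exists2 s : seq C, (size s = 3)%N /\ uniq s & {in s, forall z, z ^+ k = 1}.
Proof.
move=> le3k; have k_gt0 : (0 < k)%N by apply: leq_trans le3k.
have [r Dr] := closed_field_poly_normal ('X^k - 1 : {poly C}).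
rewrite (monicP (monic_Xn_sub_1 C k_gt0)) scale1r in Dr.
have sz_r : size r = k.
  by apply/succn_inj; rewrite -(size_prod_XsubC _ id) -Dr size_XnsubC.
exists (take 3 r); first split.
- by rewrite size_take_min sz_r; apply/minn_idPl.
- apply: take_uniq; rewrite -separable_prod_XsubC -Dr.
  by rewrite separable_Xn_sub_1 // pnatr_eq0 -lt0n.
move=> z /mem_take; rewrite -root_prod_XsubC -Dr => /rootP.
by rewrite !hornerE => /eqP; rewrite subr_eq0 => /eqP.
Qed.

(** The factors [f - z *: g] of the sum of powers are monomials up to scalars,
    and any three of them are linearly dependent. *)
Lemma mpolyX_sum_two_powers (C : numClosedFieldType) m k (a : 'X_{1..m})
    (f g : {mpoly C[m]}) :
    (3 <= k)%N -> 'X_[a] = f ^+ k + g ^+ k ->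
  exists N, 'X_[a] = N ^+ k :> {mpoly C[m]}.
Proof.
move=> le3k; have k_gt0 : (0 < k)%N by apply: leq_trans le3k.
have -> : g ^+ k = - (k.-root (-1) *: g) ^+ k.
  by rewrite exprZn rootCK // scaleN1r opprK.
move: (_ *: g) => {}g Da.
have [s [sz_s uniq_s] zk] := @three_unity_roots C k le3k.
case: s sz_s uniq_s zk => [|z1 [|z2 [|z3 []]]] //= _.
rewrite !inE andbT negb_or => /andP[/andP[ne12 ne13] ne23] zk.
have div z : z ^+ k = 1 -> exists c b, c != 0 /\ f - z *: g = c *: 'X_[b].
  move=> z1k.
  have : 'X_[a] = f ^+ k - (z *: g) ^+ k by rewrite exprZn z1k scale1r.
  rewrite subrXX => Dpq; have [c [b Db]] := mpolyX_divisor Dpq.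
  exists c, b; split=> //; apply: contra_eqN Dpq => /eqP c0.
  by rewrite Db c0 scale0r mul0r -msupp_eq0 msuppX.
have [c1 [b [nz1 D1]]] : exists c b, c != 0 /\ f - z1 *: g = c *: 'X_[b].
  by apply/div/zk; rewrite !inE eqxx.
have [c2 [b2 [nz2 D2]]] : exists c b, c != 0 /\ f - z2 *: g = c *: 'X_[b].
  by apply/div/zk; rewrite !inE eqxx orbT.
have [c3 [b3 [_ D3]]] : exists c b, c != 0 /\ f - z3 *: g = c *: 'X_[b].
  by apply/div/zk; rewrite !inE eqxx !orbT.
(* The coefficients [z2 - z3], [z3 - z1], [z1 - z2] eliminate [f] and [g] from
   the three divisors. *)
have Db2 : b = b2.
  apply: (@three_terms_proportional _ _ b b2 b3
    ((z2 - z3) * c1) ((z3 - z1) * c2) ((z1 - z2) * c3)).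
  - by rewrite mulf_neq0 // subr_eq0.
  - by rewrite mulf_neq0 // subr_eq0 eq_sym.
  rewrite -!scalerA -D1 -D2 -D3 -!mul_mpolyC !mpolyCB; ring.
rewrite -{}Db2 in D2.
(* The divisors at [z1] and [z2] determine [f] and [g]. *)
have Dg : g = (c1 - c2) / (z2 - z1) *: 'X_[b].
  rewrite mulrC -scalerA scalerBl -D1 -D2.
  have -> : f - z1 *: g - (f - z2 *: g) = (z2 - z1) *: g.
    by rewrite -!mul_mpolyC mpolyCB; ring.
  by rewrite scalerA mulVf ?scale1r // subr_eq0 eq_sym.
have Df : f = (c1 + z1 * ((c1 - c2) / (z2 - z1))) *: 'X_[b].
  by rewrite scalerDl -D1 -scalerA -Dg subrK.
move: Dg Df; set v := _ / _; set u := c1 + _ => Dg Df.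
exists (k.-root (u ^+ k - v ^+ k) *: 'X_[b]).
by rewrite Da Df Dg !exprZn rootCK // scalerBl.
Qed.

(** The leading monomial of [N] is a [k]-th root of [a], which forces its degree
    to be [d] whether or not [N] is homogeneous. *)
Lemma kth_power_monomial (C : idomainType) m k d (a : 'X_{1..m})
    (N : {mpoly C[m]}) :
    (0 < k)%N -> mdeg a = (k * d)%N -> 'X_[a] = N ^+ k ->
  exists2 g : {mpoly C[m]}, g \is d.-homog & 'X_[a] = g ^+ k.
Proof.
move=> k_gt0 ha Da; have nz_N : N != 0.
  apply: contra_eqN Da => /eqP->.
  by rewrite expr0n -[k == 0%N]negbK -lt0n k_gt0 -msupp_eq0 msuppX.
have Dm : a = (mlead N *+ k)%MM by rewrite -mleadX // -Da mleadXm.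
exists 'X_[mlead N]; last by rewrite mpolyXn -Dm.
rewrite dhomogX /=.
by rewrite -(eqn_pmul2l k_gt0) -ha Dm mdegMn mulnC.
Qed.

(** * The rank of a monomial *)

Theorem theorem3p2 (R : realType) (n k d : nat) (a : 'X_{1..n.+1})
    (hk : (2 <= k)%N) (ha : mdeg a = (k * d)%N) :
  let M : {mpoly R[i][n.+1]} := 'X_[a] in
  exists r : nat,
    [/\ is_kth_rank k d M r,
        (r <= 2 ^ k.-1)%N
      & r = 2%N <-> k = 2%N /\ ~ is_square M].
Proof.
move=> M; have k_gt0 : (0 < k)%N by apply: ltnW.
have sum_bound : sum_of_kth_powers k d M (2 ^ k.-1).
  have [[|x s] [sz_s hs Ds]] := mpolyX_factor R[i] ha.
    by rewrite -sz_s in k_gt0.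
  rewrite /M Ds big_cons; apply: prod_sum_of_kth_powers => //.
  - by apply: hs; rewrite mem_head.
  - by move=> y ys; apply: hs; rewrite inE ys orbT.
have ex_s : exists s, `[< sum_of_kth_powers k d M s >].
  by exists (2 ^ k.-1)%N; apply/asboolP.
case: (ex_minnP ex_s) => r /asboolP sum_r min_r.
have le_r t : sum_of_kth_powers k d M t -> (r <= t)%N.
  by move=> sum_t; apply/min_r/asboolP.
have power_rank N : M = N ^+ k -> (r <= 1)%N.
  move=> DN; apply: le_r; apply/sum_of_kth_powers1.
  exact: kth_power_monomial DN.
exists r; split=> //; first exact: le_r.
split=> [r2|[k2 nsq]].
  have not_power N : M <> N ^+ k by move/power_rank; rewrite r2.
  have k2 : k = 2%N.
    apply/eqP; rewrite eqn_leq hk andbT leqNgt; apply/negP => le3k.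
    have [g [_]] := sum_r; move: g; rewrite r2 => g.
    rewrite !big_ord_recl big_ord0 addr0 => /(mpolyX_sum_two_powers le3k)[N].
    exact: not_power.
  by split=> // -[N DN]; apply: (@not_power N); rewrite k2.
have := le_r _ sum_bound; rewrite k2 /=.
case: r sum_r {min_r le_r power_rank} => [|[|[|//]]] // sum_r _.
  have [g [_]] := sum_r; rewrite big_ord0 => /eqP.
  by rewrite -msupp_eq0 msuppX.
by case/sum_of_kth_powers1: sum_r => g _ Dg; case: nsq; exists g; rewrite -k2.
Qed.
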